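(* For each $\gamma \in (0,\frac{1}{2}]$ and each $0<\delta<1$, there is a sequence $(x_n)_{n\in\mathbb{N}}$ that has weak $\gamma$-PPC (with parameter $\delta$) but does not have $\gamma$-PPC.
   Context: $\|\cdot\|$ denotes the distance to the nearest integer, and $\sharp$ denotes cardinality; pairs $(m,n)$ below are ordered pairs. For $\gamma\in(0,1)$, a sequence $(x_n)_{n\in\mathbb{N}}\subseteq[0,1)$ has $\gamma$-PPC (inhomogeneous Poissonian pair correlation) if for every $s>0$, $$\lim_{N \to \infty}\frac{1}{N}\,\sharp \left\{ 1 \leq m \neq n \leq N : \|x_m - x_n-\gamma\| \leq \frac{s}{N} \right\} = 2s.$$ For $\gamma\in(0,1)$ and $0<\delta<1$, a sequence $(x_n)_{n\in\mathbb{N}}$ has weak $\gamma$-PPC (with parameter $\delta$) if for every $s>0$, $$\lim_{N\to\infty}\frac{1}{N^{2-\delta}}\,\sharp \left\{ 1 \leq m \neq n \leq N : \|x_m - x_n-\gamma\| \leq \frac{s}{N^{\delta}} \right\} =2s.$$ Sequences are considered modulo one. *)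

(* Defs.v *)
From HB Require Import structures.
From mathcomp Require Import all_boot all_order all_algebra.
From mathcomp Require Import all_classical all_reals all_analysis.

Set Implicit Arguments.
Unset Strict Implicit.
Unset Printing Implicit Defensive.

Import Order.TTheory GRing.Theory Num.Theory.
Import numFieldNormedType.Exports.

Local Open Scope classical_set_scope.
Local Open Scope ring_scope.

Definition dist_nearest_int (R : realType) (x : R) : R :=
  inf [set `|x - k%:~R| | k in [set: int]].

(* The terms involved are x 1, ..., x N; the term x 0 is never used. *)
Definition pair_count (R : realType) (x : nat -> R) (gamma r : R) (N : nat)
    : nat :=
  #|[set p : 'I_N.+1 * 'I_N.+1 |
      [&& (1 <= p.1)%N, (1 <= p.2)%N, p.1 != p.2
        & dist_nearest_int (x p.1 - x p.2 - gamma) <= r]]%SET|.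

Definition has_PPC (R : realType) (gamma : R) (x : nat -> R) : Prop :=
  forall s : R, 0 < s ->
    (pair_count x gamma (s / N%:R) N)%:R / N%:R @[N --> \oo] --> 2 * s.

Definition has_weak_PPC (R : realType) (gamma delta : R) (x : nat -> R)
    : Prop :=
  forall s : R, 0 < s ->
    (pair_count x gamma (s / N%:R `^ delta) N)%:R / N%:R `^ (2 - delta)
      @[N --> \oo] --> 2 * s.

(* Main.v *)
(* The van der Corput sequence in base 2 has weak gamma-PPC for every delta < 1
   and never has gamma-PPC.

   Halving n shows that the number of n < N with v(n) <= t differs from N t by
   at most the number of binary digits of N.  Summing over the base point, the
   number of pairs at distance at most r from gamma is 2 r N^2 + O(N log N),
   and the error is o(N^(2 - delta)).

   For N = 2^k all differences are multiples of 1 / N, so rescaling by N turns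
   the pairs counted at scale s / N into integers within s of gamma N.  There
   is at most one integer within 1/4 of gamma N, hence a nonzero count at
   s = 1/8 equals the count at s = 1/4, and the limits 1/4 and 1/2 cannot both
   hold. *)

Require Import Defs.
From HB Require Import structures.
From mathcomp Require Import all_boot all_order all_algebra.
From mathcomp Require Import all_classical all_reals all_analysis.
From mathcomp Require Import ring lra zify.

Import Order.TTheory GRing.Theory Num.Theory.
Import numFieldNormedType.Exports.

Local Open Scope classical_set_scope.
Local Open Scope ring_scope.

Lemma dist_nearest_int_le (R : realType) (x r : R) :
  dist_nearest_int x <= r <-> exists k : int, `|x - k%:~R| <= r.
Proof.
set S := [set `|x - k%:~R| | k in [set: int]].
split=> [le_r|[k le_r]]; last first.
  apply: le_trans le_r; apply: ge_inf; last by exists k.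
  by exists 0 => _ [j _ <-].
apply: contrapT => far.
have gt_r (k : int) : r < `|x - k%:~R|.
  by rewrite ltNge; apply/negP => le_k; apply: far; exists k.
set f := Num.floor x.
have [lef ltf] : f%:~R <= x /\ x < (f + 1)%:~R.
  by apply/andP; exact: floor_itv.
have gt1 := gt_r (f + 1); rewrite ler0_norm ?subr_le0 ?ltW// in gt1.
have gt0 := gt_r f; rewrite ger0_norm ?subr_ge0// in gt0.
(* The infimum is attained at the floor of [x] or at its successor: [m] bounds all the distances
   from below, so [r < m] is contradictory. *)
pose m := Num.min (x - f%:~R) ((f + 1)%:~R - x).
have lt_rm : r < m by rewrite lt_min gt0 /=; lra.
suff : m <= r by lra.
apply: le_trans le_r; apply: lb_le_inf; first by exists `|x - 0%:~R|, 0.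
move=> _ [k _ <-]; rewrite ge_min.
have [lekf|ltfk] := leP k f.
  have : (k%:~R : R) <= f%:~R by rewrite ler_int.
  by move=> lekf'; rewrite ger0_norm; [apply/orP; left|]; lra.
have : ((f + 1)%:~R : R) <= k%:~R by rewrite ler_int lezD1.
by move=> lefk; rewrite ler0_norm; [apply/orP; right|]; lra.
Qed.

(** * The van der Corput sequence *)

Section VanDerCorput.
Variable R : realType.
Implicit Types (N k n : nat) (t : R) (b : bool).

(* The first argument is fuel: [k >= n] suffices. *)
Fixpoint vdc_rec k n : R :=
  if k is k'.+1 then ((odd n)%:R + vdc_rec k' n./2) / 2 else 0.

(** The base-2 radical inverse: binary digits mirrored at the point. *)
Definition vdc n : R := vdc_rec n n.

Lemma vdc_rec0 k : vdc_rec k 0 = 0.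
Proof. by elim: k => //= k ->; rewrite addr0 mul0r. Qed.

Lemma vdc_recE k n : (n <= k)%N -> vdc_rec k n = vdc n.
Proof.
rewrite /vdc; have [m] := ubnP n; elim: m k n => // m IHm [|k] [|n] //.
  by rewrite vdc_rec0.
move=> le_nm le_nk; rewrite /=.
by rewrite IHm ?[vdc_rec n _]IHm//; lia.
Qed.

Lemma vdcE n : vdc n = ((odd n)%:R + vdc n./2) / 2.
Proof.
case: n => [|n]; first by rewrite /vdc/= addr0 mul0r.
by rewrite {1}/vdc /= vdc_recE//; lia.
Qed.

Lemma vdc_double n : vdc n.*2 = vdc n / 2.
Proof. by rewrite vdcE odd_double doubleK add0r. Qed.

Lemma vdc_doubleS n : vdc n.*2.+1 = (1 + vdc n) / 2.
Proof. by rewrite vdcE /= odd_double uphalf_double. Qed.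

Lemma vdc_itv n : 0 <= vdc n < 1.
Proof.
have [m] := ubnP n; elim: m n => // m IHm [|n] lt_nm.
  by rewrite /vdc /=; apply/andP; split; lra.
rewrite vdcE; have := IHm n.+1./2 _.
by case: (odd n.+1) => /(_ ltac:(lia)) /=; lra.
Qed.

Lemma vdc_dyadic k n : (n < 2 ^ k)%N ->
  exists j : int, vdc n * (2 ^ k)%:R = j%:~R.
Proof.
elim: k n => [|k IHk] n lt_nk.
  by exists 0; rewrite (_ : n = 0%N) ?mul0r//; lia.
have [|j Ej] := IHk n./2; first by move: lt_nk; rewrite expnS; lia.
exists ((odd n * 2 ^ k)%N%:Z + j).
rewrite vdcE expnS !natrM intrD -Ej [_%:~R]natrM; lra.
Qed.

(** * Discrepancy of initial intervals *)

Definition vdc_count b N t : R := \sum_(n < N) (vdc n < t ?<= if b)%:R.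

Lemma sum_ord_double N (f : nat -> R) :
  \sum_(n < N.*2) f n = \sum_(n < N) (f n.*2 + f n.*2.+1).
Proof.
elim: N => [|N IHN]; first by rewrite !big_ord0.
by rewrite doubleS !big_ord_recr /= IHN addrA.
Qed.

(** Even-indexed terms form a half-size copy of the sequence in [[0, 1/2)], odd-indexed ones in
    [[1/2, 1)]. A threshold cuts only one copy; the other counts fully or not at all, so the error
    carries over unchanged. *)
Lemma vdc_count_double b N t : 0 <= t <= 1 ->
  exists u, 0 <= u <= 1 /\
    vdc_count b N.*2 t - N.*2%:R * t = vdc_count b N u - N%:R * u.
Proof.
move=> t01; rewrite /vdc_count.
rewrite (sum_ord_double N (fun n => (vdc n < t ?<= if b)%:R)).
rewrite -muln2 natrM.
(* At [t = 1/2] the odd-indexed term 1/2 counts only if the comparison is not strict, so the split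
   uses the same comparison. *)
have [t_ge|t_lt] := boolP (1 / 2 < t ?<= if b).
- exists (2 * t - 1); split; first by case: b t_ge => /= t_ge; lra.
  rewrite (eq_bigr (fun n : 'I_N => 1 + (vdc n < 2 * t - 1 ?<= if b)%:R)).
    by rewrite big_split /= sumr_const card_ord; ring.
  move=> n _; rewrite vdc_double vdc_doubleS; have := vdc_itv n => v01.
  congr (_ + _%:R).
    suff -> : vdc n / 2 < t ?<= if b by [].
    by case: b t_ge => /= t_ge; lra.
  by congr nat_of_bool; case: b t_ge => /= t_ge; apply/idP/idP; lra.
- exists (2 * t); split; first by case: b t_lt => /=; lra.
  rewrite (eq_bigr (fun n : 'I_N => (vdc n < 2 * t ?<= if b)%:R)); first by ring.
  move=> n _; rewrite vdc_double vdc_doubleS; have := vdc_itv n => v01.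
  rewrite -[RHS]addr0; congr (_%:R + _).
    by congr nat_of_bool; case: b t_lt => /= t_lt; apply/idP/idP; lra.
  suff /negPf-> : ~~ ((1 + vdc n) / 2 < t ?<= if b) by [].
  by case: b t_lt => /=; lra.
Qed.

(** Each halving costs at most 1, from the last term of an odd [N]; [k] halvings exhaust [N]. *)
Lemma vdc_discrepancy01 b k N t : (N < 2 ^ k)%N -> 0 <= t <= 1 ->
  `|vdc_count b N t - N%:R * t| <= k%:R.
Proof.
elim: k N t => [|k IHk] N t lt_Nk t01.
  rewrite (_ : N = 0%N); last by lia.
  by rewrite /vdc_count big_ord0 mul0r subrr normr0.
have [u [u01 Eu]] := vdc_count_double b N./2 t t01.
have lt_N2k : (N./2 < 2 ^ k)%N by move: lt_Nk; rewrite expnS; lia.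
have IH := IHk _ _ lt_N2k u01; rewrite -Eu in IH.
rewrite -[k.+1]addn1 natrD -[in X in X <= _](odd_double_half N) addnC.
case: (odd N); last by rewrite addn0; lra.
rewrite addn1 {1}/vdc_count big_ord_recr /= -/(vdc_count b _ t) -natr1.
by move: IH; rewrite !ler_norml; case: (_ < t ?<= if b) => /=; lra.
Qed.

(** The share of [[0, 1)] below [t], which admits thresholds outside the unit interval. *)
Definition clamp01 t : R := Num.max 0 (Num.min 1 t).

Lemma clamp01_split t : 0 <= t <= 2 -> clamp01 t + clamp01 (t - 1) = t.
Proof.
rewrite /clamp01 => t02; have [t_ge1|t_lt1] := leP 1 t.
  by rewrite (max_r ler01) (@min_r _ _ 1 (t - 1)) ?(@max_r _ _ 0 (t - 1)); lra.
by rewrite (@max_r _ _ 0 t) ?(@min_r _ _ 1 (t - 1)) ?(@max_l _ _ 0 (t - 1)); lra.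
Qed.

Lemma vdc_discrepancy b k N t : (N < 2 ^ k)%N ->
  `|vdc_count b N t - N%:R * clamp01 t| <= k%:R.
Proof.
move=> lt_Nk; rewrite /clamp01.
have [t_lt0|t_ge0] := ltP t 0.
  rewrite /vdc_count big1; last first.
    move=> n _; have := vdc_itv n => v01.
    by suff /negPf-> : ~~ (vdc n < t ?<= if b) by []; case: b => /=; lra.
  by rewrite min_r ?max_l ?mulr0 ?subrr ?normr0//; lra.
have [t_gt1|t_le1] := ltP 1 t.
  rewrite /vdc_count (eq_bigr (fun=> 1)); last first.
    move=> n _; have := vdc_itv n => v01.
    by suff -> : (vdc n < t ?<= if b) by []; case: b => /=; lra.
  by rewrite sumr_const card_ord max_r ?ler01// mulr1 subrr normr0.
by rewrite max_r//; apply: vdc_discrepancy01; rewrite ?t_ge0.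
Qed.

(** * From interval counts to pair counts *)

Definition vdc_seq n : R := vdc n.-1.

(** Diagonal pairs may be included: they would put [gamma] within [r] of an integer, which
    [r < gamma <= 1/2] excludes. *)
Lemma pair_count_vdc_seq (gamma r : R) N : 0 <= r < gamma -> gamma <= 1 / 2 ->
  (pair_count vdc_seq gamma r N)%:R =
  \sum_(j < N) \sum_(i < N)
    (dist_nearest_int (vdc i - vdc j - gamma) <= r)%R%:R :> R.
Proof.
move=> r_lt gamma_le; rewrite /pair_count cardsE -sum1_card big_mkcond natr_sum.
pose F (i j : 'I_N.+1) : R := [&& (1 <= i)%N, (1 <= j)%N, i != j
  & (dist_nearest_int (vdc_seq i - vdc_seq j - gamma) <= r)%R]%:R.
rewrite (eq_bigr (fun p => F p.1 p.2)); last first.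
  by move=> [i j] _; rewrite /F unfold_in /=; case: ifP.
rewrite -(pair_bigA _ F) exchange_big big_ord_recl /= big1 ?add0r; last first.
  by move=> i _; rewrite /F /= andbF.
apply: eq_bigr => j _; rewrite big_ord_recl {1}/F add0r.
apply: eq_bigr => i _; rewrite /F /vdc_seq /= (inj_eq lift_inj).
have [->|//] := eqVneq i j; rewrite /=.
suff /negPf-> : ~~ (dist_nearest_int (vdc j - vdc j - gamma) <= r) by [].
apply/negP => /dist_nearest_int_le [k].
rewrite subrr sub0r ler_norml => k_near.
have [k_ge0|k_lt0] := leP 0 k.
  have : (0 : R) <= k%:~R by rewrite ler0z.
  by lra.
have : (k + 1)%:~R <= (0 : R) by rewrite lerz0; lia.
by rewrite intrD; lra.
Qed.

(** Only the arcs centred at [z + gamma] and [z + gamma - 1] can meet the unit interval, and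
    [r < 1/2] makes them disjoint. A closed arc is a [<=] count minus a [<] count, hence the flag of
    [vdc_count]. *)
Lemma dist_nearest_int_le_indicator (gamma r y z : R) :
  0 <= r < gamma -> gamma <= 1 / 2 -> 0 <= y < 1 -> 0 <= z < 1 ->
  (dist_nearest_int (y - z - gamma) <= r)%R%:R =
  (y <= z + gamma + r)%R%:R - (y < z + gamma - r)%R%:R
  + (y <= z + gamma - 1 + r)%R%:R - (y < z + gamma - 1 - r)%R%:R :> R.
Proof.
move=> r_lt gamma_le y01 z01.
have -> : (dist_nearest_int (y - z - gamma) <= r)
    = (z + gamma - r <= y <= z + gamma + r)
      || (z + gamma - 1 - r <= y <= z + gamma - 1 + r).
  apply/idP/idP => [/dist_nearest_int_le[k]|/orP[near|near]]; last first.
  - by apply/dist_nearest_int_le; exists (-1); rewrite ler_norml; lra.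
  - by apply/dist_nearest_int_le; exists 0; rewrite ler_norml; lra.
  rewrite ler_norml => near.
  have [k_gt0|k_le0] := ltP 0 k.
    have : (1 : R) <= k%:~R by rewrite ler1z; lia.
    by lra.
  have [k_lt|k_ge] := ltP k (-1).
    have : (k + 2)%:~R <= (0 : R) by rewrite lerz0; lia.
    by rewrite intrD; lra.
  have [k0|k1] : k = 0 \/ k = -1 by lia.
    by move: near; rewrite k0; lra.
  by move: near; rewrite k1; lra.
rewrite ![_ < _]ltNge.
case: (leP (z + gamma - r) y); case: (leP y (z + gamma + r));
case: (leP (z + gamma - 1 - r) y); case: (leP y (z + gamma - 1 + r));
by move=> /= *; lra.
Qed.

(** Each of the [N] base points involves four counts, each with error at most [k]. *)
Lemma pair_count_vdc_seq_approx (gamma r : R) k N :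
  0 <= r < gamma -> gamma <= 1 / 2 -> (N < 2 ^ k)%N ->
  `|(pair_count vdc_seq gamma r N)%:R - 2 * r * N%:R ^+ 2| <= 4 * k%:R * N%:R.
Proof.
move=> r_lt gamma_le lt_Nk; rewrite pair_count_vdc_seq//.
have -> : 2 * r * N%:R ^+ 2 = \sum_(j < N) (2 * r * N%:R) :> R.
  by rewrite sumr_const card_ord -[RHS]mulr_natr expr2 mulrA.
have -> : 4 * k%:R * N%:R = \sum_(j < N) (4 * k%:R) :> R.
  by rewrite sumr_const card_ord -[RHS]mulr_natr.
rewrite -sumrB; apply: le_trans (ler_norm_sum _ _ _) _; apply: ler_sum => j _.
have z01 := vdc_itv j; set z := vdc j in z01 *.
under eq_bigr => i _ do
  rewrite (dist_nearest_int_le_indicator _ _ _ _ r_lt gamma_le (vdc_itv i) z01).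
rewrite sumrB big_split sumrB /=.
rewrite -![\sum_(i < N) (_ <= _)%R%:R]/(vdc_count true N _).
rewrite -![\sum_(i < N) (_ < _)%R%:R]/(vdc_count false N _).
have D b t := vdc_discrepancy b k N t lt_Nk.
(* An arc running past 1 re-enters at 0, and the two pieces keep the full length [2 * r]. *)
have := clamp01_split (z + gamma + r) ltac:(lra).
have := clamp01_split (z + gamma - r) ltac:(lra).
rewrite (addrAC _ r) (addrAC _ (- r)) => sum_lo sum_hi.
have mass : 2 * r * N%:R = N%:R * clamp01 (z + gamma + r)
    - N%:R * clamp01 (z + gamma - r) + N%:R * clamp01 (z + gamma - 1 + r)
    - N%:R * clamp01 (z + gamma - 1 - r).
  rewrite -mulrBr -mulrDr -mulrBr mulrC; congr (_ * _); lra.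
move: (D true (z + gamma + r)) (D false (z + gamma - r))
  (D true (z + gamma - 1 + r)) (D false (z + gamma - 1 - r)).
rewrite mass !ler_norml; lra.
Qed.

End VanDerCorput.

(** * Asymptotics and weak pair correlation *)

Lemma near_powR_ge (R : realType) (a A : R) : 0 < a ->
  \forall N \near \oo, A <= N%:R `^ a.
Proof.
move=> a_gt0; near=> N.
have [A_ge0|A_lt0] := leP 0 A; last by rewrite (le_trans (ltW A_lt0)) ?powR_ge0.
have a_neq0 : a != 0 by rewrite gt_eqF.
rewrite (_ : A = (A `^ a^-1) `^ a); last by rewrite -powRrM mulVf ?powRr1.
apply: ge0_ler_powR; rewrite ?nnegrE ?powR_ge0 ?ler0n ?(ltW a_gt0)//.
by near: N; exact: nbhs_infty_ger.
Unshelve. all: by end_near. Qed.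

(** Follows from [ln y < y] at [y = N ^ a]. *)
Lemma trunc_log2_le_powR (R : realType) (a : R) N : 0 < a -> (0 < N)%N ->
  (trunc_log 2 N)%:R <= N%:R `^ a / (a * ln 2).
Proof.
move=> a_gt0 N_gt0; have N_pos : 0 < N%:R :> R by rewrite ltr0n.
have ln2_gt0 : 0 < ln 2 :> R by rewrite ln_gt0 ?ltr1n.
rewrite ler_pdivlMr ?mulr_gt0//.
apply: le_trans (ltW (ln_sublinear (powR_gt0 a N_pos))).
rewrite ln_powR mulrCA ler_pM2l// mulr_natl -lnXn// ler_ln ?posrE ?exprn_gt0//.
by rewrite -natrX ler_nat trunc_logP.
Qed.

Lemma vdc_seq_weak_PPC (R : realType) (gamma delta : R) :
  0 < gamma <= 1 / 2 -> 0 < delta < 1 ->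
  has_weak_PPC gamma delta (vdc_seq R).
Proof.
move=> /andP[gamma_gt0 gamma_le] /andP[delta_gt0 delta_lt1] s s_gt0.
(* Half the spare exponent: with [Y = N ^ a], the normalisation is [N * Y ^ 2]. One factor [Y]
   absorbs the logarithm, the other beats the constant. *)
pose a := (1 - delta) / 2; have a_gt0 : 0 < a by rewrite /a; lra.
have ln2_gt0 : 0 < ln 2 :> R by rewrite ln_gt0 ?ltr1n.
pose L := (a * ln 2)^-1; have L_gt0 : 0 < L by rewrite invr_gt0 mulr_gt0.
apply/cvgrPdist_le => e e_gt0; near=> N.
have N_gt0 : (0 < N)%N by near: N; exact: nbhs_infty_gt.
have N_pos : 0 < N%:R :> R by rewrite ltr0n.
have P_ge : s / gamma + 1 <= N%:R `^ delta by near: N; exact: near_powR_ge.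
(* Gives [4 * (log N + 1) <= 4 * (1 + L) * Y <= e * Y * Y], the first inequality also using
   [Y >= 1]. *)
have Y_ge : 4 * (1 + L) / e <= N%:R `^ a by near: N; exact: near_powR_ge.
have Y_ge1 : 1 <= N%:R `^ a by near: N; exact: near_powR_ge.
have logN := trunc_log2_le_powR R a N a_gt0 N_gt0.
have powD (u v : R) : N%:R `^ (u + v) = N%:R `^ u * N%:R `^ v.
  by rewrite powRD// (gt_eqF N_pos) implybT.
have NP : N%:R `^ delta * N%:R `^ (2 - delta) = N%:R ^+ 2.
  by rewrite -(powR_mulrn 2 (ltW N_pos)) -powD; congr (_ `^ _); ring.
have QE : N%:R `^ (2 - delta) = N%:R * (N%:R `^ a) ^+ 2.
  rewrite expr2 -[X in X * _](powRr1 (ltW N_pos)) -!powD.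
  by congr (_ `^ _); rewrite /a; field.
have Q_gt0 : 0 < N%:R `^ (2 - delta) by exact: powR_gt0.
have P_gt0 : 0 < N%:R `^ delta by exact: powR_gt0.
set P := N%:R `^ delta in P_ge NP P_gt0 *.
set Q := N%:R `^ (2 - delta) in NP QE Q_gt0 *.
set Y := N%:R `^ a in Y_ge Y_ge1 logN QE *.
have r_lt : 0 <= s / P < gamma.
  rewrite divr_ge0 ?ltW//= ltr_pdivrMr// mulrC -ltr_pdivrMr//; lra.
have := pair_count_vdc_seq_approx R gamma (s / P) (trunc_log 2 N).+1 N r_lt
  gamma_le (trunc_log_ltn N (isT : (1 < 2)%N)).
set c := (pair_count _ _ _ _)%:R => approx.
have -> : 2 * s - c / Q = (2 * s * Q - c) / Q by field; rewrite gt_eqF.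
have main : 2 * (s / P) * N%:R ^+ 2 = 2 * s * Q.
  by rewrite -NP; field; rewrite gt_eqF.
rewrite normrM normfV (gtr0_norm Q_gt0) ler_pdivrMr// distrC -main.
apply: le_trans approx _; rewrite -natr1 QE.
have -> : e * (N%:R * Y ^+ 2) = e * Y * Y * N%:R by ring.
rewrite ler_pM2r//.
have Y_gt0 : 0 < Y by lra.
have eY : 4 * (1 + L) <= e * Y by rewrite [e * Y]mulrC -ler_pdivrMr.
have logN' : (trunc_log 2 N)%:R <= L * Y by rewrite [L * Y]mulrC.
apply: (@le_trans _ _ (4 * (1 + L) * Y)); last by rewrite ler_pM2r.
lra.
Unshelve. all: by end_near. Qed.

(** * Failure of pair correlation along powers of two *)

Lemma pair_count_vdc_seq_dyadic (R : realType) (gamma : R) k :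
  let N := (2 ^ k)%N in
  (0 < pair_count (vdc_seq R) gamma (1 / 8 / N%:R) N)%N ->
  pair_count (vdc_seq R) gamma (1 / 4 / N%:R) N =
  pair_count (vdc_seq R) gamma (1 / 8 / N%:R) N.
Proof.
move=> N; have N_gt0 : 0 < N%:R :> R by rewrite ltr0n expn_gt0.
(* [l] is [N] times the difference, reduced modulo 1 by [m]. *)
have lattice (i j : 'I_N.+1) (s : R) : (1 <= i)%N -> (1 <= j)%N ->
  dist_nearest_int (vdc_seq R i - vdc_seq R j - gamma) <= s / N%:R <->
  exists l m : int, `|l%:~R - gamma * N%:R| <= s /\
    l%:~R = (vdc_seq R i - vdc_seq R j - m%:~R) * N%:R.
  move=> i_gt0 j_gt0; rewrite dist_nearest_int_le.
  (* From [1 <= i <= N] the shifted index [i.-1] is below [2 ^ k]. *)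
  have [u Eu] : exists u : int, vdc_seq R i * N%:R = u%:~R.
    by apply: vdc_dyadic; have := ltn_ord i; lia.
  have [v Ev] : exists v : int, vdc_seq R j * N%:R = v%:~R.
    by apply: vdc_dyadic; have := ltn_ord j; lia.
  have scale (m : int) :
      `|vdc_seq R i - vdc_seq R j - gamma - m%:~R| <= s / N%:R <->
      `|(vdc_seq R i - vdc_seq R j - m%:~R) * N%:R - gamma * N%:R| <= s.
    rewrite ler_pdivlMr// -{1}[N%:R]gtr0_norm// -normrM.
    by rewrite (_ : (_ - gamma - _) * _ =
      (vdc_seq R i - vdc_seq R j - m%:~R) * N%:R - gamma * N%:R); last by ring.
  split=> [[m /scale near]|[l [m [near El]]]]; last first.
    by exists m; apply/scale; rewrite -El.
  exists (u - v - m * N%:Z), m.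
  have -> : (u - v - m * N%:Z)%:~R =
      (vdc_seq R i - vdc_seq R j - m%:~R) * N%:R :> R.
    by rewrite !mulrBl Eu Ev !intrB intrM.
  by [].
rewrite /pair_count card_gt0 => /set0Pn[[i0 j0]].
rewrite inE /= => /and4P[i0_gt0 j0_gt0 _ /(lattice _ _ _ i0_gt0 j0_gt0)].
move=> [l0 [_ [near0 _]]].
apply: eq_card => -[i j]; rewrite !inE /=.
have [i_gt0|//] := leqP 1 i; have [j_gt0|//] := leqP 1 j; case: (i != j) => //=.
apply/idP/idP => /(lattice _ _ _ i_gt0 j_gt0)[l [m [near El]]];
  apply/(lattice _ _ _ i_gt0 j_gt0); exists l, m; split=> //; last by lra.
(* Within 1/4 and 1/8 of [gamma * N], the two integers differ by less than 1. *)
suff -> : l = l0 by [].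
move: near near0; rewrite !ler_norml => near near0.
have lt1 : (l - l0)%:~R < (1 : R) by rewrite intrB; lra.
have lt2 : (l0 - l)%:~R < (1 : R) by rewrite intrB; lra.
by move: lt1 lt2; rewrite !ltrz1; lia.
Qed.

Lemma vdc_seq_not_PPC (R : realType) (gamma : R) : ~ has_PPC gamma (vdc_seq R).
Proof.
move=> ppc.
(* The tolerance 1/16 separates the limit 1/4 both from 0 and from the limit 1/2. *)
have /cvgrPdist_le/(_ (1 / 16) ltac:(lra))[M1 _ near1] := ppc (1 / 8) ltac:(lra).
have /cvgrPdist_le/(_ (1 / 16) ltac:(lra))[M2 _ near2] := ppc (1 / 4) ltac:(lra).
have le_k k : (k <= 2 ^ k)%N by exact: ltnW (ltn_expl _ _).
have /= := near1 (2 ^ maxn M1 M2)%N (leq_trans (leq_maxl _ _) (le_k _)).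
have /= := near2 (2 ^ maxn M1 M2)%N (leq_trans (leq_maxr _ _) (le_k _)).
have [c0|c_gt0] := posnP (pair_count (vdc_seq R) gamma
  (1 / 8 / (2 ^ maxn M1 M2)%:R) (2 ^ maxn M1 M2)).
  by rewrite c0 mul0r !ler_norml; lra.
by rewrite pair_count_vdc_seq_dyadic// !ler_norml; lra.
Qed.

Theorem theorem1p1 (R : realType) (gamma delta : R)
    (gamma_gt0 : 0 < gamma) (gamma_le : gamma <= 1 / 2)
    (delta_gt0 : 0 < delta) (delta_lt1 : delta < 1) :
  exists x : nat -> R,
    [/\ forall n, 0 <= x n < 1,
        has_weak_PPC gamma delta x
      & ~ has_PPC gamma x].
Proof.
exists (vdc_seq R); split; first by move=> n; exact: vdc_itv.
- by apply: vdc_seq_weak_PPC; apply/andP.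
- exact: vdc_seq_not_PPC.
Qed.
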